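(* Let $m\ge 2$ be an integer. For every pure quaternion $c$ in the Mandelbrot set $\mathcal{M}_{\mathrm{Im}\mathbb{H}}^{m}$, we have $\|c\|\le 2^{1/(m-1)}$.
   Context: $\mathrm{Im}\,\mathbb{H}=\{ai+bj+ck : a,b,c\in\mathbb{R}\}$ is the set of pure quaternions, with Euclidean norm $\|ai+bj+ck\|=\sqrt{a^2+b^2+c^2}$. Unique spherical representation: every $q\in\mathrm{Im}\,\mathbb{H}$ is written $q=\rho(i\sin\phi\cos\theta+j\sin\phi\sin\theta+k\cos\phi)$ with $\rho=\|q\|\ge 0$, $0\le\theta<2\pi$, $0\le\phi\le\pi$; the triple $(\rho,\theta,\phi)$ is made unique by the conventions: for $q=0$ take $\theta=\phi=0$; for $q=ck$ with $c>0$ take $(c,0,0)$; for $q=ck$ with $c<0$ take $(|c|,0,\pi)$. Spherical power: $sp_m(q):=\rho^m\left(i\sin(m\phi)\cos(m\theta)+j\sin(m\phi)\sin(m\theta)+k\cos(m\phi)\right)$, where $(\rho,\theta,\phi)$ is the unique spherical representation of $q$. For $c\in\mathrm{Im}\,\mathbb{H}$ let $Q_{m,c}(q)=sp_m(q)+c$ for $q\in\mathrm{Im}\,\mathbb{H}$, and let $Q_{m,c}^{(n)}$ be its $n$-fold composition. Define $\mathcal{M}_{\mathrm{Im}\mathbb{H}}^{m}:=\{c\in\mathrm{Im}\,\mathbb{H} : \{Q_{m,c}^{(n)}(0)\}_{n\in\mathbb{N}}\text{ is bounded}\}$. *)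

(* Defs.v *)
From HB Require Import structures.
From mathcomp Require Import all_boot all_order all_algebra.
From mathcomp Require Import ring lra.
From mathcomp Require Import boolp classical_sets reals exp trigo.

Set Implicit Arguments.
Unset Strict Implicit.
Unset Printing Implicit Defensive.
Import Order.TTheory GRing.Theory Num.Theory.

Local Open Scope ring_scope.

(* Pure quaternions a i + b j + c k, identified with their coordinate vectors
   (a, b, c); only the vector space structure and the norm are used. *)
Definition ImH (R : realType) := 'rV[R]_3.

Section PureQuaternions.
Variable R : realType.
Implicit Types (q c : ImH R) (a b d rho theta phi : R).

Definition qi : ImH R := delta_mx 0 0.
Definition qj : ImH R := delta_mx 0 1.
Definition qk : ImH R := delta_mx 0 2.

(* The library norm of 'rV[R]_3 is the maximum norm, hence this one. *)
Definition qnorm q : R := Num.sqrt (\sum_(l < 3) q 0 l ^+ 2).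

Definition qdir theta phi : ImH R :=
  (sin phi * cos theta) *: qi + (sin phi * sin theta) *: qj + cos phi *: qk.

Definition spherical_rep q (p : R * R * R) : Prop :=
  let: (rho, theta, phi) := p in
  [/\ q = rho *: qdir theta phi,
      rho = qnorm q,
      0 <= theta < 2 * pi,
      0 <= phi <= pi &
      [/\ q = 0 -> theta = 0 /\ phi = 0,
          forall d, 0 < d -> q = d *: qk -> p = (d, 0, 0) &
          forall d, d < 0 -> q = d *: qk -> p = (`|d|, 0, pi)]].

Lemma qcoordP q q' :
  q 0 0 = q' 0 0 -> q 0 1 = q' 0 1 -> q 0 2 = q' 0 2 -> q = q'.
Proof.
move=> h0 h1 h2; apply/rowP => -[[|[|[|//]]] Hl].
- by rewrite (_ : Ordinal Hl = 0) //; apply/val_inj.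
- by rewrite (_ : Ordinal Hl = 1) //; apply/val_inj.
- by rewrite (_ : Ordinal Hl = 2) //; apply/val_inj.
Qed.

Lemma qcomb0 a b d : (a *: qi + b *: qj + d *: qk) 0 0 = a.
Proof. by rewrite !mxE /= mulr1 !mulr0 !addr0. Qed.

Lemma qcomb1 a b d : (a *: qi + b *: qj + d *: qk) 0 1 = b.
Proof. by rewrite !mxE /= mulr1 !mulr0 add0r addr0. Qed.

Lemma qcomb2 a b d : (a *: qi + b *: qj + d *: qk) 0 2 = d.
Proof. by rewrite !mxE /= mulr1 !mulr0 !add0r. Qed.

Lemma qnormE q :
  qnorm q = Num.sqrt (q 0 0 ^+ 2 + q 0 1 ^+ 2 + q 0 2 ^+ 2).
Proof.
rewrite /qnorm !big_ord_recl big_ord0 addr0 addrA.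
have -> : lift ord0 ord0 = 1 :> 'I_3 by apply/val_inj.
by have -> : lift ord0 (lift ord0 ord0) = 2 :> 'I_3 by apply/val_inj.
Qed.

Lemma circle_exists a b : a ^+ 2 + b ^+ 2 = 1 ->
  exists2 t : R, 0 <= t < 2 * pi & cos t = a /\ sin t = b.
Proof.
move=> h; have pi0 := pi_gt0 R.
have ha : -1 <= a <= 1 by apply/andP; split; nra.
have h1 : 1 - a ^+ 2 = b ^+ 2 by rewrite -h; ring.
have ca : cos (acos a) = a by rewrite acosK ?in_itv.
have := acos_ge0 ha; have := acos_lepi ha => l1 l0.
have sa : sin (acos a) = `|b| by rewrite sin_acos // h1 sqrtr_sqr.
have [b0|b0] := leP 0 b.
  exists (acos a); first by apply/andP; split; lra.
  by rewrite sa ger0_norm.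
have a1 : -1 <= a < 1 by apply/andP; split; nra.
have := acos_gt0 a1 => l2.
exists (2 * pi - acos a); first by apply/andP; split; lra.
have -> : 2 * pi - acos a = - acos a + pi *+ 2 :> R by ring.
by rewrite cosD2pi sinD2pi cosN sinN ca sa ltr0_norm // opprK.
Qed.

Lemma circle_inj (s t : R) : 0 <= s < 2 * pi -> 0 <= t < 2 * pi ->
  cos s = cos t -> sin s = sin t -> s = t.
Proof.
wlog st : s t / t <= s.
  move=> H hs ht hc hS; have [/H|/ltW/H h] := leP t s; first exact.
  by apply/esym/h.
move=> /andP[s0 s1] /andP[t0 t1] hc hS; have pi0 := pi_gt0 R.
have cd : cos (s - t) = 1 by rewrite cosB hc hS -!expr2 cos2Dsin2.
have [dp|dp] := leP (s - t) pi.
  suff : s - t = 0 by lra.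
  by apply: cos_inj; rewrite ?in_itv /= ?cos0 //; apply/andP; split; lra.
have e : - (s - t) + pi *+ 2 = 2 * pi - (s - t) by ring.
suff : 2 * pi - (s - t) = 0 by lra.
apply: cos_inj; rewrite ?in_itv /=; try by apply/andP; split; lra.
by rewrite -e cosD2pi cosN cd cos0.
Qed.

Lemma spherical_rep_unique q p p' :
  spherical_rep q p -> spherical_rep q p' -> p = p'.
Proof.
case: p p' => [[r t] f] [[r' t'] f'] [e er ht hf [z pos neg]].
move=> [e' er' ht' hf' [z' pos' neg']].
have rr : r' = r by rewrite er er'.
rewrite {}rr in e' er' pos' neg' *.
have [q0|q0] := eqVneq q 0.
  by have [-> ->] := z q0; have [-> ->] := z' q0.
have r0 : r != 0 by apply: contraNneq q0 => h; rewrite e h scale0r.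
have ee : qdir t f = qdir t' f' by apply: (scalerI r0); rewrite -e -e'.
have e0 : sin f * cos t = sin f' * cos t'.
  by have /(congr1 (fun M : ImH R => M 0 0)) := ee; rewrite !qcomb0.
have e1 : sin f * sin t = sin f' * sin t'.
  by have /(congr1 (fun M : ImH R => M 0 1)) := ee; rewrite !qcomb1.
have ff : f = f'.
  apply: cos_inj; rewrite ?in_itv //.
  by have /(congr1 (fun M : ImH R => M 0 2)) := ee; rewrite !qcomb2.
rewrite -{}ff in e' e0 e1 pos' neg' *.
have [sf|sf] := eqVneq (sin f) 0; last first.
  by congr (_, _, _); apply: circle_inj => //; apply: (mulfI sf).
have qe : q = (r * cos f) *: qk.
  by rewrite e /qdir sf !mul0r !scale0r !add0r scalerA.
have [h|h|h] := ltgtP (r * cos f) 0.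
- by rewrite (neg _ h qe) (neg' _ h qe).
- by rewrite (pos _ h qe) (pos' _ h qe).
- by move: q0; rewrite qe h scale0r eqxx.
Qed.

Lemma spherical_rep_exists q : exists p, spherical_rep q p.
Proof.
have pi0 := pi_gt0 R.
have nk d : qnorm (d *: qk) = `|d|.
  by rewrite qnormE !mxE /= !mulr0 mulr1 expr0n /= !add0r sqrtr_sqr.
have kc d : (d *: qk) 0 2 = d by rewrite !mxE /= mulr1.
have kneq0 d : d *: qk = 0 -> d = 0.
  by move=> /(congr1 (fun M : ImH R => M 0 2)); rewrite kc mxE.
have kinj d d' : d *: qk = d' *: qk -> d = d'.
  by move=> /(congr1 (fun M : ImH R => M 0 2)); rewrite !kc.
have [[d qd]|nok] := pselect (exists d, q = d *: qk).
  rewrite {}qd; have [h|h|->] := ltgtP d 0.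
  - exists (`|d|, 0, pi); split; rewrite ?nk ?lexx ?(ltW pi0) ?mulr_gt0 //.
      by rewrite /qdir sinpi cospi !mul0r !scale0r !add0r scalerA ltr0_norm // mulrN1 opprK.
    split=> [/kneq0 d0|d' d'0 /kinj dd|d' _ /kinj <- //].
      by rewrite d0 ltxx in h.
    by move: h; rewrite dd ltNge (ltW d'0).
  - exists (d, 0, 0); split; rewrite ?nk ?lexx ?(ltW pi0) ?mulr_gt0 //.
    + by rewrite /qdir sin0 cos0 !mul0r !scale0r !add0r scale1r.
    + by rewrite gtr0_norm.
    split=> [//|d' _ /kinj <- //|d' d'0 /kinj dd].
    by move: h; rewrite dd ltNge (ltW d'0).
  - exists (0, 0, 0); split; rewrite ?nk ?lexx ?(ltW pi0) ?mulr_gt0 ?normr0 ?scale0r //.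
    by split=> [//|d' + /esym /kneq0 dd|d' + /esym /kneq0 dd]; rewrite dd ltxx.
pose x := q 0 0; pose y := q 0 1; pose z := q 0 2.
pose s := x ^+ 2 + y ^+ 2.
have s0 : 0 < s.
  rewrite lt_neqAle eq_sym addr_ge0 ?sqr_ge0 // andbT; apply/negP => /eqP h.
  have [/eqP x0 /eqP y0] : x == 0 /\ y == 0.
    by move/eqP: h; rewrite paddr_eq0 ?sqr_ge0 // !sqrf_eq0 => /andP[].
  apply: nok; exists z; apply: qcoordP; last by rewrite kc.
    by rewrite -/x x0 !mxE /= mulr0.
  by rewrite -/y y0 !mxE /= mulr0.
pose u := Num.sqrt s; pose r := qnorm q.
have u2 : u ^+ 2 = s by rewrite sqr_sqrtr // ltW.
have u0 : 0 < u by rewrite sqrtr_gt0.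
have r2 : r ^+ 2 = s + z ^+ 2.
  by rewrite /r qnormE -/x -/y -/z sqr_sqrtr // addr_ge0 ?sqr_ge0 // ltW.
have r0 : 0 < r.
  rewrite lt_neqAle sqrtr_ge0 andbT eq_sym; apply/negP => /eqP h.
  by move: r2; rewrite h; have := sqr_ge0 z; nra.
have hz : (z / r) ^+ 2 + (u / r) ^+ 2 = 1.
  by rewrite !expr_div_n u2 -mulrDl addrC -r2 divff // expf_neq0 // gt_eqF.
have hu : (x / u) ^+ 2 + (y / u) ^+ 2 = 1.
  by rewrite !expr_div_n -mulrDl u2 divff // gt_eqF.
have [t ht [ct st]] := circle_exists hu.
have hzr : -1 <= z / r <= 1.
  by have := sqr_ge0 (u / r); have := hz; move=> *; apply/andP; split; nra.
pose f := acos (z / r).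
have cf : cos f = z / r by rewrite acosK ?in_itv.
have sf : sin f = u / r.
  rewrite sin_acos // (_ : 1 - _ = (u / r) ^+ 2); last by rewrite -hz; ring.
  by rewrite sqrtr_sqr ger0_norm // divr_ge0 ?ltW.
exists (r, t, f); split=> //; last 2 first.
- by rewrite acos_ge0 ?acos_lepi.
- split.
  + by move=> q0; case: nok; exists 0; rewrite scale0r.
  + by move=> d _ qd; case: nok; exists d.
  + by move=> d _ qd; case: nok; exists d.
rewrite /qdir sf ct st cf !scalerDr !scalerA; apply: qcoordP.
- by rewrite qcomb0 -/x; field; rewrite !gt_eqF.
- by rewrite qcomb1 -/y; field; rewrite !gt_eqF.
- by rewrite qcomb2 -/z; field; rewrite !gt_eqF.
Qed.

(* By [spherical_rep_unique], the choice made by [cid] is the only one. *)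
Definition spherical q : R * R * R := projT1 (cid (spherical_rep_exists q)).

Lemma sphericalP q : spherical_rep q (spherical q).
Proof. exact: projT2 (cid (spherical_rep_exists q)). Qed.

Definition sp (m : nat) q : ImH R :=
  let: (rho, theta, phi) := spherical q in
  rho ^+ m *: qdir (m%:R * theta) (m%:R * phi).

Definition Q (m : nat) c : ImH R -> ImH R := fun q => sp m q + c.

Definition mandelbrot (m : nat) : set (ImH R) :=
  [set c | exists B : R, forall n : nat, qnorm (iter n (Q m c) 0) <= B]%classic.

End PureQuaternions.

(* Main.v *)
Require Import Defs.
From mathcomp Require Import all_boot all_order all_algebra.
From mathcomp Require Import boolp classical_sets reals exp trigo.
From mathcomp Require Import ring lra.
Import Order.TTheory GRing.Theory Num.Theory.
Local Open Scope ring_scope.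

(** Write [r] for the norm of [c]. The spherical power raises norms to the
    [m]-th power, so as long as [r <= |x|] the next iterate has norm at least
    [|x|^m - r >= |x| (r^(m-1) - 1)]. If [2 < r^(m-1)], then every step adds at
    least the positive constant [r (r^(m-1) - 2)] to the norm, and the orbit
    escapes. *)

Lemma qnorm_ge0 (R : realType) (q : ImH R) : 0 <= qnorm q.
Proof. exact: sqrtr_ge0. Qed.

Lemma qnorm_sqr (R : realType) (q : ImH R) :
  qnorm q ^+ 2 = q 0 0 ^+ 2 + q 0 1 ^+ 2 + q 0 2 ^+ 2.
Proof. by rewrite qnormE sqr_sqrtr // !addr_ge0 ?sqr_ge0. Qed.

Lemma qnormN (R : realType) (q : ImH R) : qnorm (- q) = qnorm q.
Proof. by rewrite !qnormE !mxE !sqrrN. Qed.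

Lemma qnormZ (R : realType) (a : R) (q : ImH R) :
  qnorm (a *: q) = `|a| * qnorm q.
Proof.
by rewrite !qnormE !mxE !exprMn -!mulrDr sqrtrM ?sqr_ge0 // sqrtr_sqr.
Qed.

Lemma qnorm_qdir (R : realType) (theta phi : R) : qnorm (qdir theta phi) = 1.
Proof.
rewrite qnormE qcomb0 qcomb1 qcomb2 !exprMn -mulrDr cos2Dsin2 mulr1.
by rewrite addrC cos2Dsin2 sqrtr1.
Qed.

(** Squaring both sides reduces this to the Cauchy-Schwarz inequality. *)
Lemma ler_qnormD (R : realType) (p q : ImH R) :
  qnorm (p + q) <= qnorm p + qnorm q.
Proof.
have p0 := qnorm_ge0 _ p; have q0 := qnorm_ge0 _ q.
rewrite -ler_sqr ?nnegrE ?addr_ge0 ?qnorm_ge0 // sqrrD !qnorm_sqr !mxE.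
set a := p 0 0; set b := p 0 1; set d := p 0 2.
set x := q 0 0; set y := q 0 1; set z := q 0 2.
suff : a * x + b * y + d * z <= qnorm p * qnorm q by lra.
apply: le_trans (ler_norm _) _.
rewrite -ler_sqr ?nnegrE ?mulr_ge0 // real_normK ?num_real // exprMn !qnorm_sqr.
rewrite -/a -/b -/d -/x -/y -/z -subr_ge0.
(* Lagrange's identity *)
have -> : (a ^+ 2 + b ^+ 2 + d ^+ 2) * (x ^+ 2 + y ^+ 2 + z ^+ 2)
    - (a * x + b * y + d * z) ^+ 2
  = (a * y - b * x) ^+ 2 + (a * z - d * x) ^+ 2 + (b * z - d * y) ^+ 2 by ring.
by rewrite !addr_ge0 ?sqr_ge0.
Qed.

(** Multiplying the angles by [m] still gives a unit direction, so only the factor [rho ^+ m]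
    affects the norm. *)
Lemma qnorm_sp (R : realType) (m : nat) (q : ImH R) :
  qnorm (sp m q) = qnorm q ^+ m.
Proof.
rewrite /sp; have := sphericalP q; case: spherical => [[rho theta] phi] [_ -> _ _ _].
by rewrite qnormZ qnorm_qdir mulr1 ger0_norm // exprn_ge0 // qnorm_ge0.
Qed.

Lemma qnorm0 (R : realType) : qnorm (0 : ImH R) = 0.
Proof. by rewrite -(scale0r 0) qnormZ normr0 mul0r. Qed.

(** Triangle inequality for [sp m q = Q m c q + (- c)]. *)
Lemma qnorm_Q_ge (R : realType) (m : nat) (c q : ImH R) :
  qnorm q ^+ m - qnorm c <= qnorm (Q m c q).
Proof.
rewrite lerBlDr -qnorm_sp -(qnormN _ c).
by apply: le_trans (ler_qnormD _ _ _); rewrite /Q addrK.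
Qed.

Lemma qnorm_Q0 (R : realType) (m : nat) (c : ImH R) :
  qnorm (Q m.+1 c 0) = qnorm c.
Proof.
have /eqP : qnorm (sp m.+1 (0 : ImH R)) = 0 by rewrite qnorm_sp qnorm0 expr0n.
rewrite -sqrf_eq0 qnorm_sqr !paddr_eq0 ?addr_ge0 ?sqr_ge0 // !sqrf_eq0.
by move=> /andP[/andP[/eqP h0 /eqP h1] /eqP h2]; rewrite !qnormE !mxE h0 h1 h2 !add0r.
Qed.

(** The induction starts at the first iterate, of norm [qnorm c], since the orbit itself starts at
    0. *)
Lemma qnorm_iter_Q_ge (R : realType) (m : nat) (c : ImH R) (n : nat) :
  2 <= qnorm c ^+ m ->
  qnorm c + n%:R * (qnorm c * (qnorm c ^+ m - 2))
    <= qnorm (iter n.+1 (Q m.+1 c) 0).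
Proof.
move=> c2; have c0 := qnorm_ge0 _ c.
elim: n => [|n IHn]; first by rewrite mul0r addr0 /= qnorm_Q0.
rewrite iterS; apply: le_trans (qnorm_Q_ge _ _ _ _).
set x := iter n.+1 _ _ in IHn *.
have d0 : 0 <= qnorm c * (qnorm c ^+ m - 2) by rewrite mulr_ge0 // subr_ge0.
have cx : qnorm c <= qnorm x by apply: le_trans IHn; rewrite lerDl mulr_ge0.
have cxm : qnorm c ^+ m <= qnorm x ^+ m by rewrite lerXn2r ?nnegrE ?qnorm_ge0.
have h1 : qnorm x * qnorm c ^+ m <= qnorm x * qnorm x ^+ m.
  by rewrite ler_wpM2l ?qnorm_ge0.
have h2 : qnorm c * (qnorm c ^+ m - 2) <= qnorm x * (qnorm c ^+ m - 2).
  by rewrite ler_wpM2r ?subr_ge0.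
(* By [h1] and [h2], the left-hand power is at least [qnorm c * (qnorm c ^+ m - 2) + 2 * qnorm x];
   by [cx], one copy of [qnorm x] absorbs the subtracted [qnorm c], and [IHn] bounds the other. *)
rewrite exprS -natr1; lra.
Qed.

Lemma mandelbrot_qnormX_le2 (R : realType) (m : nat) (c : ImH R) :
  mandelbrot m.+1 c -> qnorm c ^+ m <= 2.
Proof.
move=> [B hB]; rewrite leNgt; apply/negP => c2.
have [c0|c0] := eqVneq (qnorm c) 0.
  (* Here the power is 1 or 0, according to whether [m] is 0. *)
  by move: c2; rewrite c0 expr0n; case: (m == 0)%N => /=; lra.
have d0 : 0 < qnorm c * (qnorm c ^+ m - 2).
  by rewrite mulr_gt0 ?subr_gt0 // lt_neqAle eq_sym c0 qnorm_ge0.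
(* After [n] increments of size [d] the norm exceeds [B]. *)
pose d := qnorm c * (qnorm c ^+ m - 2); pose n := Num.bound `|B / d|.
have Bn : B < n%:R * d.
  rewrite -ltr_pdivrMr //; apply: le_lt_trans (ler_norm _) _; exact: archi_boundP (normr_ge0 _).
have := qnorm_iter_Q_ge _ _ _ n (ltW c2).
by have := hB n.+1; have := qnorm_ge0 _ c; rewrite -/d; lra.
Qed.

Theorem theorem11 (R : realType) (m : nat) (hm : (2 <= m)%N)
    (c : ImH R) (hc : mandelbrot m c) :
  qnorm c <= 2 `^ (1 / (m%:R - 1)).
Proof.
case: m hm hc => [//|[//|m]] _ /mandelbrot_qnormX_le2 c2.
(* The exponent is now [m.+2], so raising to the power [m.+1] cancels the root. *)
rewrite -(@ler_pXn2r _ m.+1) ?nnegrE ?qnorm_ge0 ?powR_ge0 //.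
rewrite -[leRHS]powR_mulrn ?powR_ge0 // -powRrM -[m.+2%:R]natr1 addrK.
by rewrite mul1r mulVf ?pnatr_eq0 // powRr1.
Qed.
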